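(* Let $n,k$ be positive integers. A restraint $r$ on the complete graph $K_n$ is a proper $k$-restraint if and only if $r\in R_{\max}(K_n,k)$.
   Context: A restraint $r$ on a graph $G$ assigns to each vertex $v$ a finite set $r(v)\subset\mathbb{N}$ of forbidden colours; a proper $x$-colouring $c$ of $G$ is permitted by $r$ if $c(v)\notin r(v)$ for all $v$, and $\pi_r(G,x)$ denotes the number of proper $x$-colourings permitted by $r$. If $G$ has $n$ vertices, a $k$-restraint is a restraint with $|r(v)|=k$ and $r(v)\subseteq\{1,2,\dots,kn\}$ for every vertex $v$. A restraint is proper if $r(u)\cap r(v)=\emptyset$ for every edge $uv$. $R_{\max}(G,k)$ is the set of $k$-restraints $r$ on $G$ such that for every $k$-restraint $r'$ on $G$, $\pi_r(G,x)\geq\pi_{r'}(G,x)$ for all sufficiently large $x$. *)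

(* Defs.v *)
From mathcomp Require Export all_boot finmap.

Set Implicit Arguments.
Unset Strict Implicit.
Unset Printing Implicit Defensive.

Record sgraph := SGraph {
  vertex :> finType;
  adj : rel vertex;
  adj_sym : symmetric adj;
  adj_irrefl : irreflexive adj
}.

Definition complete_adj (n : nat) : rel 'I_n := fun i j => i != j.

Fact complete_adj_sym (n : nat) : symmetric (@complete_adj n).
Proof. by move=> i j; rewrite /complete_adj eq_sym. Qed.

Fact complete_adj_irrefl (n : nat) : irreflexive (@complete_adj n).
Proof. by move=> i; rewrite /complete_adj eqxx. Qed.

Definition complete_graph (n : nat) : sgraph :=
  SGraph (@complete_adj_sym n) (@complete_adj_irrefl n).

Definition restraint (G : sgraph) := G -> {fset nat}.

(* The colours are 1, ..., x; the ordinal i : 'I_x stands for the colour i.+1. *)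
Definition colour (x : nat) (i : 'I_x) : nat := i.+1.

Definition proper_colouring (G : sgraph) (x : nat) (c : {ffun G -> 'I_x}) : bool :=
  [forall u, forall v, adj u v ==> (c u != c v)].

Definition permitted (G : sgraph) (r : restraint G) (x : nat)
    (c : {ffun G -> 'I_x}) : bool :=
  [forall v, colour (c v) \notin r v].

Definition restrained_chromatic (G : sgraph) (r : restraint G) (x : nat) : nat :=
  #|[set c : {ffun G -> 'I_x} | proper_colouring c && permitted r c]|.

Definition k_restraint (G : sgraph) (k : nat) (r : restraint G) : Prop :=
  forall v : G,
    #|` r v| = k /\ (forall a : nat, a \in r v -> 1 <= a <= k * #|G|).

Definition proper_restraint (G : sgraph) (r : restraint G) : Prop :=
  forall u v : G, adj u v -> (r u `&` r v = fset0)%fset.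

Definition Rmax (G : sgraph) (k : nat) (r : restraint G) : Prop :=
  k_restraint k r /\
  forall r' : restraint G, k_restraint k r' ->
    exists N : nat, forall x : nat, N <= x ->
      restrained_chromatic r' x <= restrained_chromatic r x.

(* Main.v *)
Require Import Defs.
From mathcomp Require Import all_boot finmap.
From mathcomp Require Import perm zify.

(** Fix a palette of [x >= k * n + n] colours.  If a [k]-restraint on [K_n] is
    not proper, double counting yields a colour [a] forbidden at two vertices
    [u] and [v], and a colour [b <= k * n] forbidden nowhere.  Replacing [a] by
    [b] at [u] strictly increases the number of permitted colourings: keep a
    colouring [c] if [c u != b], and otherwise exchange the colours [a] and [b]
    in it; this is injective and misses every colouring with [u] coloured [a]
    and [v] coloured [b].  Each exchange enlarges the set of forbidden colours,
    so one ends with a proper restraint.  Finally, any two proper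
    [k]-restraints partition [{1, ..., k * n}] into blocks of size [k], hence
    differ by a permutation of the colours and permit equally many colourings. *)

(** * Families of forbidden sets over a finite palette *)

Section Families.

Set Implicit Arguments.
Unset Strict Implicit.

Variables V T : finType.
Implicit Types (S : V -> {set T}) (P : {set T}) (c : {ffun V -> T}).

Definition avoiding_injection S c : bool :=
  injectiveb c && [forall v, c v \notin S v].

Definition avoiding_injections S : {set {ffun V -> T}} :=
  [set c | avoiding_injection S c].

Definition uniform_family P k S : Prop :=
  forall v, #|S v| = k /\ S v \subset P.

Definition disjoint_family S : Prop :=
  forall u v a, a \in S u -> a \in S v -> u = v.

Definition replace_colour S (u : V) (a b : T) : V -> {set T} :=
  fun w => if w == u then b |: (S u :\ a) else S w.

Lemma avoiding_injectionP S c :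
  reflect (injective c /\ forall v, c v \notin S v) (avoiding_injection S c).
Proof.
apply: (iffP andP) => [[/injectiveP ci /forallP cS]|[ci cS]]; split => //.
  exact/injectiveP.
exact/forallP.
Qed.

Section Exchange.

Variables (S : V -> {set T}) (P : {set T}) (u v : V) (a b : T).
Hypotheses (neq_uv : u != v) (aSu : a \in S u) (aSv : a \in S v).
Hypothesis bS : forall w, b \notin S w.

Definition exchange c : {ffun V -> T} :=
  if c u == b then [ffun w => tperm a b (c w)] else c.

(** In the swapped case [u] receives [a], now allowed there. By injectivity no other vertex had [b],
    so no other vertex receives [a]; a vertex that had [a] receives [b], which is forbidden nowhere
    in [S]. *)
Lemma exchange_avoiding c :
  avoiding_injection S c -> avoiding_injection (replace_colour S u a b) (exchange c).
Proof.
case/avoiding_injectionP => ci cS; apply/avoiding_injectionP.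
have neq_ab : a != b by apply: contraTneq aSu => ->; exact: bS.
rewrite /exchange; case: ifP => [/eqP cub|/negbT cub]; split.
- by move=> w1 w2; rewrite !ffunE => /perm_inj/ci.
- move=> w; rewrite ffunE /replace_colour; case: eqP => [->|/eqP neq_wu].
    by rewrite cub tpermR !inE eqxx (negPf neq_ab).
  case: tpermP => [_|cwb|_ _]; [exact: bS| |exact: cS].
  by case/eqP: neq_wu; apply: ci; rewrite cwb cub.
- exact: ci.
- move=> w; rewrite /replace_colour; case: eqP => [->|_]; last exact: cS.
  by rewrite !inE negb_or cub negb_and cS orbT.
Qed.

(** As [a] is forbidden at [u], the image takes the value [a] at [u] exactly when the swap was made,
    so the image reveals which case applied. *)
Lemma exchange_inj : {in avoiding_injections S &, injective exchange}.
Proof.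
have neq_cua c : c \in avoiding_injections S -> c u != a.
  rewrite inE => /avoiding_injectionP[_ cS].
  by apply: contraNneq (cS u) => ->.
move=> c d cS dS; rewrite /exchange.
case: eqP => [cu|_]; case: eqP => [du|_] //.
- by move/ffunP=> e; apply/ffunP=> w; have := e w; rewrite !ffunE => /perm_inj.
- move/ffunP/(_ u); rewrite ffunE cu tpermR => e.
  by have := neq_cua d dS; rewrite -e eqxx.
- move/ffunP/(_ u); rewrite ffunE du tpermR => e.
  by have := neq_cua c cS; rewrite e eqxx.
Qed.

Lemma exchange_missed c : avoiding_injection S c ->
  exchange c u = a -> exchange c v = b -> False.
Proof.
case/avoiding_injectionP => _ cS; rewrite /exchange.
case: eqP => [_|_] e1 e2; last by have := cS u; rewrite e1 aSu.
have cva : c v = a by apply: (@perm_inj _ (tperm a b)); rewrite tpermL -[RHS]e2 ffunE.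
by have := cS v; rewrite cva aSv.
Qed.

Hypotheses (SP : forall w, S w \subset P) (bP : b \in P).
Hypothesis card_outside : #|V| <= #|~: P|.

Lemma missed_avoiding :
  exists c, [/\ avoiding_injection (replace_colour S u a b) c, c u = a & c v = b].
Proof.
have aP : a \in P by apply: (subsetP (SP u)).
have neq_ab : a != b by apply: contraTneq aSu => ->; exact: bS.
(* The vertices other than [u] and [v] get distinct colours outside [P], where nothing is
   forbidden. *)
pose f w := enum_val (widen_ord card_outside (enum_rank w)).
have fP w : f w \notin P by have := enum_valP (widen_ord card_outside (enum_rank w)); rewrite inE.
have f_inj : injective f.
  by move=> w1 w2 /enum_val_inj/(congr1 val)/= /val_inj/enum_rank_inj.
pose c := [ffun w => if w == u then a else if w == v then b else f w].
exists c; split; last 2 first.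
- by rewrite ffunE eqxx.
- by rewrite ffunE eq_sym (negPf neq_uv) eqxx.
have fneqa w : f w <> a by move=> e; have := fP w; rewrite e aP.
have fneqb w : f w <> b by move=> e; have := fP w; rewrite e bP.
apply/avoiding_injectionP; split.
  move=> w1 w2; rewrite !ffunE.
  case: (w1 =P u) => [->|_]; case: (w2 =P u) => [->|_] //.
  - case: (w2 =P v) => [_ e|_ e]; first by rewrite e eqxx in neq_ab.
    by case: (fneqa w2).
  - case: (w1 =P v) => [_ e|_ e]; first by rewrite e eqxx in neq_ab.
    by case: (fneqa w1).
  - case: (w1 =P v) => [->|_]; case: (w2 =P v) => [->|_] //.
    + by move=> e; case: (fneqb w2).
    + by move=> e; case: (fneqb w1).
    + exact: f_inj.
move=> w; rewrite ffunE /replace_colour.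
case: eqP => [_|_]; first by rewrite !inE eqxx (negPf neq_ab).
case: eqP => [_|_]; first exact: bS.
by apply: contra (fP w); exact/subsetP.
Qed.

Lemma card_avoiding_replace :
  #|avoiding_injections S| < #|avoiding_injections (replace_colour S u a b)|.
Proof.
rewrite -(card_in_imset exchange_inj).
apply/proper_card/properP; split.
  by apply/subsetP=> _ /imsetP[c cS ->]; rewrite inE in cS; rewrite inE exchange_avoiding.
have [c [cS' cu cv]] := missed_avoiding.
exists c; first by rewrite inE.
apply/negP=> /imsetP[d]; rewrite inE => dS e.
by apply: (exchange_missed dS); rewrite -e.
Qed.

Lemma replace_uniform k :
  uniform_family P k S -> uniform_family P k (replace_colour S u a b).
Proof.
move=> unifS w; rewrite /replace_colour; case: eqP => // _.
have [cardSu SuP] := unifS u; split.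
  by rewrite cardsU1 !inE (negPf (bS u)) andbF /= -cardSu [in RHS](cardsD1 a) aSu.
by rewrite subUset sub1set bP (subset_trans (subsetDl _ _) SuP).
Qed.

(** Progress measure for the repeated exchange: [a] stays forbidden at [v], while [b] becomes
    forbidden for the first time. *)
Lemma support_replace :
  #|\bigcup_w S w| < #|\bigcup_w replace_colour S u a b w|.
Proof.
apply/proper_card/properP; split; last first.
  exists b; last by apply/bigcupP=> -[w _]; apply/negP.
  by apply/bigcupP; exists u; rewrite // /replace_colour eqxx !inE eqxx.
apply/subsetP=> d /bigcupP[w _ dSw]; apply/bigcupP.
have [da|neq_da] := eqVneq d a.
  by exists v; rewrite // /replace_colour eq_sym (negPf neq_uv) da.
exists w => //; rewrite /replace_colour; case: eqP dSw => // -> dSu.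
by rewrite !inE neq_da dSu orbT.
Qed.

End Exchange.

(** * Double counting and disjoint families *)

Lemma uniform_double_count P k S : uniform_family P k S ->
  \sum_(a in P) #|[set v | a \in S v]| = k * #|V|.
Proof.
move=> unifS; transitivity (\sum_(a in P) \sum_v (a \in S v : nat)).
  by apply: eq_bigr => a _; rewrite -sum1dep_card [LHS]big_mkcond; apply: eq_bigr => v _; case: (a \in S v).
rewrite exchange_big /= mulnC -sum_nat_const; apply: eq_bigr => v _.
have [<- SvP] := unifS v; rewrite -sum1_card big_mkcond [RHS]big_mkcond /=.
apply: eq_bigr => a _; have := subsetP SvP a.
by case: (a \in S v) => [->|_] //; case: (a \in P).
Qed.

(** The multiplicities of the colours of [P] sum to [k * #|V| = #|P|]. Disjointness bounds each by
    1, so the equality case of the summed bound forces each to be 1. *)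
Lemma disjoint_uniform_cover P k S : #|P| = k * #|V| ->
    uniform_family P k S -> disjoint_family S ->
  forall a, a \in P -> exists v, a \in S v.
Proof.
move=> cardP unifS disjS a aP.
have le1 d : d \in P -> #|[set v | d \in S v]| <= 1 ?= iff (#|[set v | d \in S v]| == 1).
  move=> _; split=> //; rewrite leqNgt; apply/negP => /card_gt1P[u [v []]].
  by rewrite !inE => uS vS /eqP; apply; apply: disjS uS vS.
have [_] := leqif_sum le1.
rewrite (uniform_double_count unifS) sum1_card cardP eqxx => /esym/forall_inP/(_ a aP) card1.
have /card_gt0P[v] : 0 < #|[set v | a \in S v]| by rewrite (eqP card1).
by rewrite inE; exists v.
Qed.

(** The same equality case, with each multiplicity now bounded below by 1. *)
Lemma cover_uniform_disjoint P k S : #|P| = k * #|V| ->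
    uniform_family P k S -> (forall a, a \in P -> exists v, a \in S v) ->
  disjoint_family S.
Proof.
move=> cardP unifS coverS u v a aSu aSv.
have aP : a \in P by apply: (subsetP (unifS u).2).
have ge1 d : d \in P -> 1 <= #|[set v | d \in S v]| ?= iff (1 == #|[set v | d \in S v]|).
  move=> /coverS[w dSw]; split=> //; apply/card_gt0P; exists w; by rewrite inE.
have [_] := leqif_sum ge1.
rewrite (uniform_double_count unifS) sum1_card cardP eqxx => /esym/forall_inP/(_ a aP).
rewrite eq_sym => /cards1P[w Ew].
have : u \in [set v | a \in S v] by rewrite inE.
have : v \in [set v | a \in S v] by rewrite inE.
by rewrite Ew !inE => /eqP-> /eqP.
Qed.

Lemma card_avoiding_disjoint P k S S0 : #|P| = k * #|V| ->
    uniform_family P k S -> disjoint_family S ->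
    uniform_family P k S0 -> disjoint_family S0 ->
  #|avoiding_injections S| <= #|avoiding_injections S0|.
Proof.
move=> cardP unifS disjS unifS0 disjS0.
(* The recolouring [s] matches each block [S v] with [S0 v] in enumeration order and fixes the
   colours in no block, which all lie outside [P]. Disjointness of [S] makes the picked vertex
   unique. *)
pose s a := if [pick v | a \in S v] is Some v
            then nth a (enum (S0 v)) (index a (enum (S v))) else a.
have sS v a : a \in S v -> s a = nth a (enum (S0 v)) (index a (enum (S v))).
  move=> aSv; rewrite /s; case: pickP => [w aSw|/(_ v)]; last by rewrite aSv.
  by rewrite (disjS _ _ _ aSw aSv).
have idx v a : a \in S v -> index a (enum (S v)) < size (enum (S0 v)).
  by move=> aSv; rewrite -cardE (unifS0 v).1 -(unifS v).1 cardE index_mem mem_enum.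
have sS0 v a : a \in S v -> s a \in S0 v.
  by move=> aSv; rewrite (sS v) // -mem_enum mem_nth ?idx.
have sN a : (forall v, a \notin S v) -> s a = a /\ a \notin P.
  move=> aS; rewrite /s; case: pickP => [w|_]; first by rewrite (negPf (aS w)).
  split=> //; apply/negP=> /(disjoint_uniform_cover cardP unifS disjS)[v].
  exact/negP.
have caseS a : (exists v, a \in S v) \/ (forall v, a \notin S v).
  case: (pickP (fun v => a \in S v)) => [v aSv|aS]; first by left; exists v.
  by right=> v; rewrite aS.
(* This gives both the injectivity of [s] and the fact that composing with [s] turns avoidance of
   [S] into avoidance of [S0]. *)
have s_reflect v a : s a \in S0 v -> a \in S v.
  case: (caseS a) => [[w aSw] saS0|/sN[-> aP] aS0].
    by rewrite -(disjS0 _ _ _ (sS0 w a aSw) saS0).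
  by rewrite (subsetP (unifS0 v).2) in aP.
have s_inj : injective s.
  move=> a d; case: (caseS a) => [[v aSv]|aS] eq_s.
    have dSv : d \in S v by apply: s_reflect; rewrite -eq_s sS0.
    move: eq_s; rewrite (sS v) // (sS v d) // (set_nth_default d) ?idx //.
    move/eqP; rewrite nth_uniq ?idx ?enum_uniq // => /eqP eq_i.
    by rewrite -[a](nth_index a (s := enum (S v))) ?mem_enum // eq_i nth_index // mem_enum.
  case: (caseS d) => [[v dSv]|dS].
    have : a \in S v by apply: s_reflect; rewrite eq_s sS0.
    by rewrite (negPf (aS v)).
  by move: eq_s; rewrite (sN a aS).1 (sN d dS).1.
pose F c : {ffun V -> T} := [ffun v => s (c v)].
have F_inj : injective F.
  move=> c d /ffunP e; apply/ffunP=> v; apply: s_inj.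
  by have := e v; rewrite !ffunE.
rewrite -(card_imset _ F_inj); apply/subset_leq_card/subsetP=> d /imsetP[c].
rewrite !inE => /avoiding_injectionP[ci cS] ->; apply/avoiding_injectionP; split.
  by move=> u v; rewrite !ffunE => /s_inj/ci.
by move=> v; rewrite ffunE; apply: contra (cS v); apply: s_reflect.
Qed.

Lemma disjoint_or_repeated P k S : #|P| = k * #|V| -> uniform_family P k S ->
  disjoint_family S \/
  exists u v a b, [/\ u != v, a \in S u, a \in S v, b \in P & forall w, b \notin S w].
Proof.
move=> cardP unifS.
case: (pickP (fun b => (b \in P) && [forall w, b \notin S w])) => [b|noB]; last first.
  left; apply: (cover_uniform_disjoint cardP unifS) => a aP.
  have := noB a; rewrite aP /= => /forallPn[v]; rewrite negbK; by exists v.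
case/andP=> bP /forallP bS; right.
case: (pickP (fun t : V * V * T => [&& t.1.1 != t.1.2, t.2 \in S t.1.1 & t.2 \in S t.1.2])).
  by case=> [[u v] a] /and3P[uv au av]; exists u, v, a, b.
move=> noA; have disjS : disjoint_family S.
  move=> u v a au av; apply/eqP/negbNE/negP=> uv.
  by have := noA (u, v, a); rewrite /= uv au av.
have [v bSv] := disjoint_uniform_cover cardP unifS disjS bP.
by have := bS v; rewrite bSv.
Qed.

Lemma card_avoiding_max P k S S0 : #|P| = k * #|V| -> #|V| <= #|~: P| ->
    uniform_family P k S -> uniform_family P k S0 -> disjoint_family S0 ->
  #|avoiding_injections S| <= #|avoiding_injections S0| /\
  (disjoint_family S \/ #|avoiding_injections S| < #|avoiding_injections S0|).
Proof.
move=> cardP cardCP + unifS0 disjS0.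
(* Induction on the number of colours forbidden nowhere, which drops at each exchange. *)
have [m] := ubnP (#|T| - #|\bigcup_w S w|); elim: m S => // m IHm S le_m unifS.
have [disjS|[u [v [a [b [uv aSu aSv bP bS]]]]]] := disjoint_or_repeated cardP unifS.
  by split; [exact: card_avoiding_disjoint unifS0 disjS0|left].
have SP w := (unifS w).2.
have lt_S' := card_avoiding_replace uv aSu aSv bS SP bP cardCP.
have lt_supp := support_replace uv aSv bS.
have [] := IHm _ _ (replace_uniform aSu bS bP unifS).
  apply: leq_trans (ltn_sub2l (leq_trans lt_supp (max_card _)) lt_supp) _.
  by rewrite -ltnS.
move=> le_S0 _; have lt_S0 := leq_trans lt_S' le_S0.
by split; [exact: ltnW|right].
Qed.

End Families.

(** * Transfer to restraints on the complete graph *)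

Section CompleteGraph.

Set Implicit Arguments.
Unset Strict Implicit.

Variables n k : nat.
Implicit Type r : restraint (complete_graph n).

Definition palette_restraint r x (v : 'I_n) : {set 'I_x} :=
  [set i | colour i \in r v].

(** Since [i] stands for the colour [i.+1], the strict bound describes the colours from 1 to
    [k * n]. *)
Definition low_colours x : {set 'I_x} := [set i : 'I_x | i < k * n].

Lemma restrained_chromatic_complete r x :
  restrained_chromatic r x = #|avoiding_injections (palette_restraint r x)|.
Proof.
rewrite /restrained_chromatic; apply: eq_card => c; rewrite !inE.
congr andb; last by apply: eq_forallb => v; rewrite inE.
apply/forallP/injectiveP => [cP u v eq_c|ci u].
  apply/eqP/negbNE/negP => uv.
  by have := forallP (cP u) v; rewrite /= /complete_adj uv eq_c eqxx.
apply/forallP => v; apply/implyP; by apply: contraNneq => /ci->.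
Qed.

Lemma card_low_colours x : k * n <= x -> #|low_colours x| = k * n.
Proof.
move=> le_x; rewrite -[RHS]card_ord -(card_imset predT (f := widen_ord le_x)).
  apply: eq_card => i; rewrite !inE; apply/idP/imsetP => [lt_i|[j _ ->]] /=; last exact: ltn_ord.
  by exists (Ordinal lt_i) => //; apply: val_inj.
by move=> i j /(congr1 val)/= /val_inj.
Qed.

Lemma palette_restraint_uniform r x : k * n <= x -> k_restraint k r ->
  uniform_family (low_colours x) k (palette_restraint r x).
Proof.
move=> le_x kr v; have [card_rv rvP] := kr v; rewrite card_ord in rvP.
split; last first.
  by apply/subsetP=> i; rewrite !inE => /rvP/andP[].
rewrite -card_rv cardE -(size_map (@colour x)); apply: perm_size; apply: uniq_perm.
- by rewrite map_inj_uniq ?enum_uniq // => i j [] /val_inj.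
- exact: fset_uniq.
move=> a; apply/mapP/idP => [[i]|a_rv]; first by rewrite mem_enum inE => + ->.
have /andP[a_gt0 a_le] := rvP _ a_rv.
have lt_a : a.-1 < x by lia.
by exists (Ordinal lt_a); rewrite ?mem_enum ?inE /colour /= prednK.
Qed.

Lemma palette_restraint_disjoint r x : k * n <= x -> k_restraint k r ->
  disjoint_family (palette_restraint r x) <-> proper_restraint r.
Proof.
move=> le_x kr; split=> [disjr u v uv|propr u v i].
  apply/eqP; rewrite fsetI_eq0; apply/fdisjointP => a a_u; apply/negP => a_v.
  have := (kr u).2 _ a_u; rewrite card_ord => /andP[a_gt0 a_le].
  have lt_a : a.-1 < x by lia.
  have e : u = v by apply: (disjr u v (Ordinal lt_a)); rewrite inE /colour /= prednK.
  by move: uv; rewrite e adj_irrefl.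
rewrite !inE => iu iv; apply/eqP/negbNE/negP=> uv.
have /fsetP/(_ (colour i)) := propr u v uv.
by rewrite !inE iu iv.
Qed.

(** Consecutive blocks of length [k], starting from colour 1: a concrete proper [k]-restraint
    against which any maximiser can be compared. *)
Definition block_restraint : restraint (complete_graph n) :=
  fun v : 'I_n => [fset a in iota (v * k).+1 k]%fset.

Lemma mem_block_restraint (v : 'I_n) a :
  (a \in block_restraint v) = (v * k < a <= v * k + k).
Proof. by rewrite !inE mem_iota; lia. Qed.

Lemma block_k_restraint : k_restraint k block_restraint.
Proof.
move=> v; split.
  by rewrite card_fseq undup_id ?iota_uniq // size_iota.
move=> a; rewrite mem_block_restraint card_ord.
have lt_v : v < n by exact: ltn_ord.
move: (nat_of_ord v) lt_v => m; nia.
Qed.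

Lemma block_proper_restraint : proper_restraint block_restraint.
Proof.
move=> u v uv; apply/eqP; rewrite fsetI_eq0; apply/fdisjointP => a.
rewrite !mem_block_restraint => a_u; apply/negP => a_v.
move/negP: uv; apply; apply/eqP/val_inj => /=.
move: (nat_of_ord u) (nat_of_ord v) a_u a_v => p q; nia.
Qed.

(** The bound on [x] leaves at least [n] colours above [k * n], enough to build the colouring missed
    by the exchange. *)
Lemma restrained_chromatic_max r r' x : k * n + n <= x ->
    k_restraint k r -> k_restraint k r' -> proper_restraint r' ->
  restrained_chromatic r x <= restrained_chromatic r' x /\
  (proper_restraint r \/ restrained_chromatic r x < restrained_chromatic r' x).
Proof.
move=> le_x kr kr' propr'; have le_kn : k * n <= x by lia.
rewrite !restrained_chromatic_complete -(palette_restraint_disjoint le_kn kr).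
apply: (card_avoiding_max (P := low_colours x) (k := k)).
- by rewrite card_low_colours ?card_ord.
- by rewrite cardsCs setCK card_low_colours // !card_ord; lia.
- exact: palette_restraint_uniform.
- exact: palette_restraint_uniform.
- exact/palette_restraint_disjoint.
Qed.

End CompleteGraph.

Theorem theorem4p2 (n k : nat) (hn : 0 < n) (hk : 0 < k)
    (r : restraint (complete_graph n)) :
  (k_restraint k r /\ proper_restraint r) <-> Rmax k r.
Proof.
split=> [[kr propr]|[kr maxr]]; split=> //.
  move=> r' kr'; exists (k * n + n) => x le_x.
  by have [] := restrained_chromatic_max le_x kr' kr propr.
have [N leN] := maxr _ (@block_k_restraint n k).
(* A palette size past both thresholds: there maximality of [r] rules out the strict inequality, so
   [r] is proper. *)
have le_x : k * n + n <= N + (k * n + n) by exact: leq_addl.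
have [_ [//|]] := restrained_chromatic_max le_x kr (@block_k_restraint n k) (@block_proper_restraint n k).
by rewrite ltnNge leN ?leq_addr.
Qed.
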